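(* Let $A:\mathcal{H}_1\to\mathcal{H}_2$ be a nonzero bounded linear operator between real Hilbert spaces and let $T:\mathcal{H}_2\to\mathcal{H}_2$ be $\rho$-SQNE, where $\rho\ge 0$. Assume that $\operatorname{im}A\cap\operatorname{Fix}T\neq\emptyset$. Let $\mathcal{L}\{T\}:\mathcal{H}_1\to\mathcal{H}_1$ be the Landweber operator corresponding to $T$. Then the following statements hold. (i) If $T$ is weakly regular, then $\mathcal{L}\{T\}$ is weakly regular. (ii) If $\operatorname{im}A$ is closed, $T$ is boundedly regular and the family $\{\operatorname{im}A,\operatorname{Fix}T\}$ is boundedly regular, then $\mathcal{L}\{T\}$ is boundedly regular. (iii) If $\operatorname{im}A$ is closed, $T$ is boundedly linearly regular and the family $\{\operatorname{im}A,\operatorname{Fix}T\}$ is boundedly linearly regular, then $\mathcal{L}\{T\}$ is boundedly linearly regular.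
   Context: $\mathcal{H}_1,\mathcal{H}_2$ are real Hilbert spaces; $A^*$ is the adjoint of $A$, $\operatorname{im}A$ its image, $\|A\|$ its operator norm. $\operatorname{Fix}T$ is the fixed point set of $T$, $d(x,C)=\inf_{c\in C}\|x-c\|$, and $\rightharpoonup$ denotes weak convergence. Landweber operator: $\mathcal{L}\{T\}x:=x+\frac{1}{\|A\|^2}A^*(T(Ax)-Ax)$ for $x\in\mathcal{H}_1$. $\rho$-SQNE ($\rho$-strongly quasi-nonexpansive, $\rho\ge 0$): $T$ (not necessarily linear) has $\operatorname{Fix}T\ne\emptyset$ and $\|Tx-z\|^2\le\|x-z\|^2-\rho\|Tx-x\|^2$ for all $x$ and all $z\in\operatorname{Fix}T$. Regular operators. An operator $U$ on a Hilbert space $\mathcal{H}$ with $\operatorname{Fix}U\neq\emptyset$ is: - weakly regular if for any sequence $\{x_k\}\subseteq\mathcal{H}$ and any $x_\infty\in\mathcal{H}$, whenever a subsequence $x_{n_k}\rightharpoonup x_\infty$ and $Ux_k-x_k\to0$ then $x_\infty\in\operatorname{Fix}U$; - boundedly regular if for every bounded sequence $\{x_k\}$, $\|Ux_k-x_k\|\to0$ implies $d(x_k,\operatorname{Fix}U)\to0$; - boundedly linearly regular if for every bounded set $S\subseteq\mathcal{H}$ there is $\delta_S>0$ with $\|Ux-x\|\ge\delta_S\,d(x,\operatorname{Fix}U)$ for every $x\in S$. Regular families of sets. A family $\{C_1,\dots,C_m\}$ of closed convex sets with $C:=\bigcap_iC_i\neq\emptyset$ is: - boundedly regular if for every bounded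 sequence $\{x_k\}$, $\max_i d(x_k,C_i)\to0$ implies $d(x_k,C)\to0$; - boundedly linearly regular if for every bounded set $S$ there is $\kappa_S>0$ with $d(x,C)\le\kappa_S\max_i d(x,C_i)$ for every $x\in S$. *)

(* Defs.v *)
From HB Require Import structures.
From mathcomp Require Import all_boot all_order all_algebra.
From mathcomp Require Import all_classical all_reals all_analysis.

Set Implicit Arguments.
Unset Strict Implicit.
Unset Printing Implicit Defensive.

Import Order.TTheory GRing.Theory Num.Theory.
Import numFieldNormedType.Exports.

Local Open Scope classical_set_scope.
Local Open Scope ring_scope.

(* A real Hilbert space is a complete normed module whose norm comes from a
   symmetric positive definite bilinear form. *)
HB.mixin Record NormedModule_hasInner (R : realType) H
    of NormedModule R H := {
  inner : {dot H for (@idfun R)} ;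
  innerE : forall x : H, inner x x = `|x| ^+ 2
}.

#[short(type="hilbertType")]
HB.structure Definition Hilbert (R : realType) :=
  {H of CompleteNormedModule R H & NormedModule_hasInner R H}.

Arguments inner {R s}.

Section Operators.
Context {R : realType}.

Definition opnorm (H1 H2 : hilbertType R) (A : H1 -> H2) : R :=
  sup [set `|A x| | x in [set x : H1 | `|x| <= 1]].

(* For bounded linear A, such a point z exists (Riesz representation) and is
   unique; the default value 0 is only relevant to other functions A. *)
Definition adjoint (H1 H2 : hilbertType R) (A : H1 -> H2) (y : H2) : H1 :=
  xget 0 [set z : H1 | forall x : H1, inner (A x) y = inner x z].

Definition landweber (H1 H2 : hilbertType R) (A : H1 -> H2) (T : H2 -> H2)
    (x : H1) : H1 :=
  x + (opnorm A ^+ 2)^-1 *: adjoint A (T (A x) - A x).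

Definition fixpts (H : hilbertType R) (U : H -> H) : set H :=
  [set x | U x = x].

(* Distance to C; meaningful only when C is nonempty. *)
Definition dist (H : hilbertType R) (x : H) (C : set H) : R :=
  inf [set `|x - c| | c in C].

Definition weak_cvg (H : hilbertType R) (x : nat -> H) (l : H) : Prop :=
  forall y : H, inner (x n) y @[n --> \oo] --> inner l y.

Definition sqne (H : hilbertType R) (rho : R) (T : H -> H) : Prop :=
  fixpts T !=set0 /\
  forall x z : H, fixpts T z ->
    `|T x - z| ^+ 2 <= `|x - z| ^+ 2 - rho * `|T x - x| ^+ 2.

Definition weakly_regular (H : hilbertType R) (U : H -> H) : Prop :=
  fixpts U !=set0 /\
  forall (x : nat -> H) (l : H) (n : nat -> nat),
    increasing_seq n -> weak_cvg (x \o n) l ->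
    U (x k) - x k @[k --> \oo] --> (0 : H) ->
    fixpts U l.

Definition boundedly_regular (H : hilbertType R) (U : H -> H) : Prop :=
  fixpts U !=set0 /\
  forall x : nat -> H, bounded_fun x ->
    `|U (x k) - x k| @[k --> \oo] --> (0 : R) ->
    dist (x k) (fixpts U) @[k --> \oo] --> (0 : R).

Definition boundedly_linearly_regular (H : hilbertType R) (U : H -> H) : Prop :=
  fixpts U !=set0 /\
  forall S : set H, bounded_set S ->
    exists2 delta : R, 0 < delta &
      forall x : H, S x -> delta * dist x (fixpts U) <= `|U x - x|.

Definition closed_convex_family (H : hilbertType R) (m : nat)
    (C : 'I_m -> set H) : Prop :=
  (forall i, closed (C i) /\ convex_set (C i)) /\ \bigcap_i C i !=set0.

(* The unit 0 of the maximum is harmless because distances are nonnegative. *)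
Definition max_dist (H : hilbertType R) (m : nat) (C : 'I_m -> set H)
    (x : H) : R :=
  \big[Num.max/0]_(i < m) dist x (C i).

Definition boundedly_regular_family (H : hilbertType R) (m : nat)
    (C : 'I_m -> set H) : Prop :=
  closed_convex_family C /\
  forall x : nat -> H, bounded_fun x ->
    max_dist C (x k) @[k --> \oo] --> (0 : R) ->
    dist (x k) (\bigcap_i C i) @[k --> \oo] --> (0 : R).

Definition boundedly_linearly_regular_family (H : hilbertType R) (m : nat)
    (C : 'I_m -> set H) : Prop :=
  closed_convex_family C /\
  forall S : set H, bounded_set S ->
    exists2 kappa : R, 0 < kappa &
      forall x : H, S x -> dist x (\bigcap_i C i) <= kappa * max_dist C x.

End Operators.

(* Main.v *)
Require Import Defs.
From HB Require Import structures.
From mathcomp Require Import all_boot all_order all_algebra.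
From mathcomp Require Import all_classical all_reals all_analysis.
From mathcomp Require Import ring lra.

(** Write [L] for the Landweber operator, [a] for the operator norm of [A] and
[A*] for its adjoint.  Everything rests on one inequality.  For [u] arbitrary
and [z] a fixed point of [T], expanding the square in the quasi-nonexpansivity
of [T] gives [|T u - u|^2 <= 2 <z - u, T u - u>] ([sqne_residual_le]).  Taking
[u = A x] and a fixed point of the form [A z], and moving [A] across the inner
product, turns the right-hand side into [2 a^2 <z - x, L x - x>], so that
[|T (A x) - A x|^2 <= 2 a^2 |L x - x| |x - z|] ([landweber_residual_le]): a
small Landweber step forces a small step of [T] at [A x].  In particular
[Fix L] is the preimage of [Fix T] under [A], and taking the infimum over [z]
replaces [|x - z|] by [d(x, Fix L)].

For weak regularity, a weakly convergent sequence is bounded, so the inequality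
makes the residuals of [T] along its image vanish; as [A] is weakly continuous,
weak regularity of [T] applies to the image.

For the two bounded regularities, the hypotheses on [T] and on the pair of sets
control [d(A x, im A `&` Fix T)] by the residual of [T] at [A x], and it remains
to control [d(x, Fix L)] by that distance.  This is where closedness of the
image enters: each [A x] has a preimage of norm at most a constant multiple of
[|A x|] ([closed_range_preimage_bound]), and correcting [x] by a short preimage
of [A x - c], for [c] in [im A `&` Fix T], produces a nearby point of [Fix L].
In the linear case this yields an estimate
[d(x, Fix L)^2 <= C |L x - x| d(x, Fix L)], from which one factor cancels.

The preimage bound is obtained by duality.  The elements [y] of a closed image
with [|A* y| <= 1] are pointwise bounded as functionals, because each vector
projects to some [A x] and [<y, A x> = <A* y, x>]; by uniform boundedness they
are bounded, so [|y| <= K |A* y|] on the image.  Projecting [x] onto the closure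
of [A* (im A)] then gives a preimage of [A x] of norm at most [K |A x|].
Orthogonal projection also yields the Riesz representation theorem, hence the
adjoint identity. *)

Set Implicit Arguments.
Unset Strict Implicit.
Unset Printing Implicit Defensive.

Import Order.TTheory GRing.Theory Num.Theory.
Import numFieldNormedType.Exports.

Local Open Scope classical_set_scope.
Local Open Scope ring_scope.

(** * Inner products *)

Section InnerProduct.
Context {R : realType} {H : hilbertType R}.
Implicit Types (x y z : H) (a : R).

Lemma innerC x y : inner x y = inner y x.
Proof. by have := hermitian_subproof (s := @inner R H) x y; rewrite expr0 mul1r. Qed.

Lemma innerDl x y z : inner (x + y) z = inner x z + inner y z.
Proof. exact: linearDl. Qed.

Lemma innerBl x y z : inner (x - y) z = inner x z - inner y z.
Proof. exact: linearBl. Qed.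

Lemma innerZl a x y : inner (a *: x) y = a * inner x y.
Proof. exact: linearZl_LR. Qed.

Lemma innerDr x y z : inner x (y + z) = inner x y + inner x z.
Proof. exact: linearDr. Qed.

Lemma innerBr x y z : inner x (y - z) = inner x y - inner x z.
Proof. exact: linearBr. Qed.

Lemma innerZr a x y : inner x (a *: y) = a * inner x y.
Proof. exact: linearZr_LR. Qed.

Lemma normDsq x y : `|x + y| ^+ 2 = `|x| ^+ 2 + 2 * inner x y + `|y| ^+ 2.
Proof. rewrite -!innerE innerDl !innerDr (innerC y x); ring. Qed.

Lemma normBsq x y : `|x - y| ^+ 2 = `|x| ^+ 2 - 2 * inner x y + `|y| ^+ 2.
Proof. rewrite -!innerE innerBl !innerBr (innerC y x); ring. Qed.

Lemma parallelogram x y :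
  `|x + y| ^+ 2 + `|x - y| ^+ 2 = 2 * (`|x| ^+ 2 + `|y| ^+ 2).
Proof. rewrite normDsq normBsq; ring. Qed.

(** Cauchy-Schwarz, read off from the triangle inequality of the norm by squaring
it and expanding. *)
Lemma inner_le_norm x y : inner x y <= `|x| * `|y|.
Proof.
have : `|x + y| ^+ 2 <= (`|x| + `|y|) ^+ 2.
  by rewrite lerXn2r ?nnegrE ?addr_ge0// ler_normD.
rewrite normDsq sqrrD; lra.
Qed.

Lemma norm_inner_le x y : `|inner x y| <= `|x| * `|y|.
Proof.
rewrite ler_norml inner_le_norm andbT lerNl.
have -> : - inner x y = inner (- x) y by rewrite linearNl.
by rewrite (le_trans (inner_le_norm _ _))// normrN.
Qed.

Lemma inner_injr y z : (forall x, inner x y = inner x z) -> y = z.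
Proof.
move=> yz; apply/eqP; rewrite -subr_eq0 -normr_eq0 -sqrf_eq0 -innerE.
by rewrite innerBr yz subrr.
Qed.

End InnerProduct.

(** * Distance to a set, closure and boundedness *)

Section Distance.
Context {R : realType} {H : hilbertType R}.
Implicit Types (x c : H) (C : set H).

Lemma dist_le x c C : C c -> dist x C <= `|x - c|.
Proof.
move=> Cc; apply: ge_inf; last by exists c.
by exists 0 => _ [d _ <-].
Qed.

Lemma le_dist x C (b : R) : C !=set0 ->
  (forall c, C c -> b <= `|x - c|) -> b <= dist x C.
Proof.
move=> [c Cc] bC; apply: lb_le_inf; first by exists `|x - c|, c.
by move=> _ [d Cd <-]; exact: bC.
Qed.

Lemma dist_ge0 x C : C !=set0 -> 0 <= dist x C.
Proof. by move=> C0; exact: le_dist. Qed.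

Lemma dist_mem x C : C x -> dist x C = 0.
Proof.
move=> Cx; apply/eqP; rewrite eq_le dist_ge0 ?andbT; last by exists x.
by rewrite (le_trans (dist_le _ Cx))// subrr normr0.
Qed.

Lemma dist_lt x C (e : R) : C !=set0 -> 0 < e ->
  exists2 c, C c & `|x - c| < dist x C + e.
Proof.
move=> [c Cc] e0.
have [|_ [d Cd <-] de] := @inf_adherent R [set `|x - c| | c in C] _ e0.
  by split; [exists `|x - c|, c|exists 0 => _ [d _ <-]].
by exists d.
Qed.

Lemma closure_approx C x (e : R) : closure C x -> 0 < e ->
  exists2 c, C c & `|x - c| < e.
Proof.
move=> /(_ (ball x e)) Cx e0; have [|c [Cc xc]] := Cx.
  by apply/nbhs_ballP; exists e.
by exists c => //; move: xc; rewrite -ball_normE.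
Qed.

(** Together with [max_dist_pair], makes the regularity conditions on a family
of two sets explicit. *)
Lemma bigcap_pair (C D : set H) :
  \bigcap_i tnth [tuple C; D] i = C `&` D.
Proof.
apply/seteqP; split=> [y CD|y [Cy Dy] i _].
  by split; [exact: (CD ord0)|exact: (CD ord_max)].
by case: i => -[|[|//]] ?.
Qed.

(** Only the second set contributes at a point of the first one, which is how the
family is used at points [A x]. *)
Lemma max_dist_pair (C D : set H) y : C y -> D !=set0 ->
  max_dist (tnth [tuple C; D]) y = dist y D.
Proof.
move=> Cy D0; rewrite /max_dist !big_ord_recl big_ord0.
rewrite !(tnth_nth C)/= dist_mem//.
by rewrite (max_l (dist_ge0 _ D0)) max_r// dist_ge0.
Qed.

End Distance.

Lemma bounded_inP (T : Type) (R : realType) (V : normedModType R)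
    (f : T -> V) (D : set T) :
  [bounded f x | x in D] <->
  exists2 M : R, 0 < M & forall x, D x -> `|f x| <= M.
Proof.
split=> [/ex_strict_bound_gt0[M M0 fM]|[M M0 fM]].
  by exists M => // x Dx; exact/ltW/fM.
by exists M; split; [exact: num_real|move=> N /ltW MN x Dx; exact/le_trans/MN/fM].
Qed.

(** * Orthogonal projection, Riesz representation, uniform boundedness *)

Section Projection.
Context {R : realType} {H : hilbertType R}.

Definition linear_subspace (M : set H) : Prop :=
  M 0 /\ forall (a : R) u v, M u -> M v -> M (a *: u + v).

(** The midpoint of [u] and [v] lies in [M], hence at distance at least
[dist x M] from [x]; the parallelogram identity then leaves little room for
[u - v].  This is what makes minimizing sequences Cauchy. *)
Lemma near_minimizer_dist (M : set H) (x u v : H) (e : R) :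
  linear_subspace M -> M u -> M v ->
  `|x - u| <= dist x M + e -> `|x - v| <= dist x M + e ->
  `|u - v| ^+ 2 <= 4 * ((2 * dist x M + e) * e).
Proof.
move=> [M0 Ml] Mu Mv xu xv.
have Mm : M (2^-1 *: (u + v)).
  rewrite scalerDr; apply: (Ml) => //.
  by rewrite -[_ *: v]addr0; exact: Ml.
have d0 : 0 <= dist x M by apply: dist_ge0; exists 0.
have mid : 4 * dist x M ^+ 2 <= `|(x - u) + (x - v)| ^+ 2.
  have -> : (x - u) + (x - v) = 2 *: (x - 2^-1 *: (u + v)).
    rewrite scalerBr scalerA divff// scale1r scaler_nat mulr2n.
    by rewrite addrACA opprD.
  rewrite normrZ exprMn ger0_norm// -natrX ler_wpM2l//.
  by rewrite lerXn2r ?nnegrE//; exact: dist_le.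
have := parallelogram (x - u) (x - v).
have -> : (x - u) - (x - v) = v - u by rewrite opprB addrC addrA subrK.
rewrite distrC => par.
have sq (w : H) : `|x - w| <= dist x M + e ->
    `|x - w| ^+ 2 <= (dist x M + e) ^+ 2.
  by move=> xw; rewrite lerXn2r ?nnegrE// (le_trans _ xw).
move: (sq _ xu) (sq _ xv); lra.
Qed.

(** By completeness, since the tails of such a sequence have small diameter. *)
Lemma minimizing_seq_cvg (M : set H) (x : H) : linear_subspace M ->
  exists2 m : nat -> H, (forall n, M (m n)) &
    (forall n, `|x - m n| < dist x M + n.+1%:R^-1) /\ cvgn m.
Proof.
move=> Msub; have M0 : M !=set0 by exists 0; case: Msub.
have d0 : 0 <= dist x M by exact: dist_ge0.
have /choice[m mP] (n : nat) : exists c, M c /\ `|x - c| < dist x M + n.+1%:R^-1.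
  by have [|c] := @dist_lt _ _ x M n.+1%:R^-1 M0; [rewrite invr_gt0|exists c].
exists m => [n|]; first by case: (mP n).
split=> [n|]; first by case: (mP n).
apply/cauchy_cvgP/cauchy_exP => e e0; rewrite /fmapE/=.
set d := dist x M in d0 mP *.
(* With [c <= 1], [near_minimizer_dist] bounds the squared distance between
   terms by [4 (2 d + c) c <= (8 d + 4) c], which is then below [e ^+ 2]. *)
set c := Num.min 1 (e ^+ 2 / (8 * d + 8)).
have c0 : 0 < c by rewrite lt_min ltr01 divr_gt0 ?exprn_gt0//; lra.
have [N _ Nc] := near_infty_natSinv_lt (PosNum c0).
exists (m N), N => // n /= Nn.
rewrite -ball_normE/= -(ltr_pXn2r (n := 2))// ?nnegrE ?(ltW e0)//.
have le_c k : (N <= k)%N -> `|x - m k| <= d + c.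
  move=> Nk; apply/ltW; rewrite (lt_trans (mP k).2)// ltrD2l.
  exact: (Nc k Nk).
apply: le_lt_trans (near_minimizer_dist Msub (mP N).1 (mP n).1
  (le_c _ (leqnn N)) (le_c _ Nn)) _; rewrite -/d.
have c1 : c <= 1 by rewrite ge_min lexx.
have : c <= e ^+ 2 / (8 * d + 8) by rewrite ge_min lexx orbT.
rewrite ler_pdivlMr; last by lra.
nra.
Qed.

(** The limit [p] of a minimizing sequence realizes the distance from [x] to [M],
so [t |-> |x - p - t w|^2] is minimal at [t = 0] for each [w] in [M], which
forces [<x - p, w> = 0].  Since [p] is only known to be a limit of points of [M],
it lies in the closure; in this form the lemma covers closed images, kernels and
images under the adjoint alike. *)
Lemma projection (M : set H) (x : H) : linear_subspace M ->
  exists2 p : H, closure M p & forall m, M m -> inner (x - p) m = 0.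
Proof.
move=> Msub; have [m Mm [mx /cvg_ex[/= p mp]]] := minimizing_seq_cvg x Msub.
have d0 : 0 <= dist x M by apply: dist_ge0; exists 0; case: Msub.
have clMp : closure M p.
  apply: (@closed_cvg _ _ _ _ _ (closure M) (@closed_closure _ M) _ _ mp).
  by apply: nearW => n; apply: subset_closure.
have xp : `|x - p| <= dist x M.
  apply/ler_addgt0Pr => e e0; have e20 : 0 < e / 2 by rewrite divr_gt0.
  near \oo => n.
  have pn : `|p - m n| <= e / 2.
    by near: n; exact: cvgr_dist_le.
  have en : n.+1%:R^-1 < e / 2.
    by near: n; exact: (near_infty_natSinv_lt (PosNum e20)).
  rewrite -(subrKA (m n)) (le_trans (ler_normD _ _))// (distrC (m n)).
  by move: (mx n) en; set i := n.+1%:R^-1; lra.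
exists p => // w Mw.
have far (t : R) : dist x M <= `|x - p - t *: w|.
  apply/ler_addgt0Pr => e e0; have [q Mq pq] := closure_approx clMp e0.
  have Mqw : M (t *: w + q) by case: Msub => _; exact.
  rewrite (le_trans (dist_le x Mqw))//.
  have -> : x - (t *: w + q) = (x - p - t *: w) + (p - q).
    by rewrite addrAC subrKA opprD addrA addrAC.
  by rewrite (le_trans (ler_normD _ _))// lerD2l ltW.
have quad (t : R) : 0 <= t ^+ 2 * `|w| ^+ 2 - 2 * t * inner (x - p) w.
  have : `|x - p| ^+ 2 <= `|x - p - t *: w| ^+ 2.
    by rewrite lerXn2r ?nnegrE// (le_trans xp).
  rewrite [leRHS]normBsq normrZ exprMn real_normK ?num_real// innerZr; lra.
have [->|w0] := eqVneq w 0; first by rewrite linear0r.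
(* This [t] minimizes the quadratic, whose minimum is [- <x-p,w>^2 / |w|^2]. *)
have := quad (inner (x - p) w / `|w| ^+ 2).
have nw : `|w| ^+ 2 != 0 by rewrite sqrf_eq0 normr_eq0.
set c := inner _ _.
have -> : (c / `|w| ^+ 2) ^+ 2 * `|w| ^+ 2 - 2 * (c / `|w| ^+ 2) * c =
  - (c ^+ 2 / `|w| ^+ 2) by field; rewrite normr_eq0.
rewrite oppr_ge0 pmulr_lle0; last by rewrite invr_gt0 exprn_gt0// normr_gt0.
by move=> c2; apply/eqP; rewrite -sqrf_eq0 eq_le c2 sqr_ge0.
Unshelve. all: by end_near. Qed.

(** A vector [w] orthogonal to the kernel of [f] represents [f] up to a scalar,
because [x - (f x / f w) w] lies in that kernel for each [x]. *)
Lemma riesz (f : H -> R) (K : R) : 0 < K ->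
  (forall (a : R) u v, f (a *: u + v) = a * f u + f v) ->
  (forall x, `|f x| <= K * `|x|) ->
  exists z, forall x, f x = inner x z.
Proof.
move=> K0 fl fK.
have f0 : f 0 = 0.
  by apply/eqP; rewrite -normr_le0 (le_trans (fK _))// normr0 mulr0.
have fB u v : f (u - v) = f u - f v.
  have -> : u - v = -1 *: v + u by rewrite scaleN1r addrC.
  by rewrite fl mulN1r addrC.
have [fz|/existsNP[x0 /eqP fx0]] := pselect (forall x, f x = 0).
  by exists 0 => x; rewrite linear0r.
pose M := [set x | f x = 0].
have Msub : linear_subspace M.
  by split=> [|a u v]; rewrite /M/= ?f0// fl => -> ->; rewrite mulr0 addr0.
have [p pM px] := projection x0 Msub.
have fp : f p = 0.
  apply/eqP; rewrite -normr_le0; apply/ler_addgt0Pr => e e0.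
  have [q Mq pq] := closure_approx pM (divr_gt0 e0 K0).
  have -> : f p = f (p - q).
    by rewrite fB (Mq : f q = 0) subr0.
  by rewrite add0r (le_trans (fK _))// mulrC -ler_pdivlMr// ltW.
set w := x0 - p.
have fw : f w = f x0 by rewrite fB fp subr0.
have w0 : `|w| ^+ 2 != 0.
  rewrite sqrf_eq0 normr_eq0; apply: contra_neq fx0 => w0.
  by rewrite -fw w0.
exists ((f w / `|w| ^+ 2) *: w) => x.
have Mx : M ((- (f x / f w)) *: w + x).
  by rewrite /M/= fl mulNr divfK ?addNr// fw.
have := px _ Mx; rewrite -/w innerDr !innerZr innerE [inner w x]innerC.
move=> /eqP; rewrite addrC addr_eq0 => /eqP ->.
by field; rewrite fw fx0/=; rewrite sqrf_eq0 in w0.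
Qed.

(** Uniform boundedness for the functionals [inner y], whose operator norm is the
norm of [y]. *)
Lemma pointwise_bounded_norm (B : set H) :
  (forall u, exists M : R, forall y, B y -> `|inner y u| <= M) ->
  exists2 M : R, 0 < M & forall y, B y -> `|y| <= M.
Proof.
move=> Bw; pose F := [set (inner y : H -> R^o) | y in B].
have Flin f : F f -> bounded_fun_norm f /\ linear f.
  move=> [y _ <-]; split=> [r|a u v]; last by rewrite innerDr innerZr.
  exists (`|y| * r) => x xr.
  by rewrite (le_trans (norm_inner_le _ _))// ler_wpM2l.
have Fpt : pointwise_bounded F.
  by move=> u; have [M BM] := Bw u; exists M => _ [y By <-]; exact: BM.
have [M FM] := Banach_Steinhauss Flin Fpt 1.
exists (Num.max 1 M) => [|y By]; first by rewrite lt_max ltr01.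
have [->|y0] := eqVneq y 0; first by rewrite normr0 le_max ler01.
have ny : `|y| != 0 by rewrite normr_eq0.
have := FM _ (ex_intro2 _ _ y By erefl) (`|y|^-1 *: y).
rewrite normrZ normfV normr_id mulVf// lexx => /(_ isT).
by rewrite innerZr innerE expr2 mulKf// normr_id le_max => ->; rewrite orbT.
Qed.

Lemma weak_cvg_bounded (x : nat -> H) (l : H) : weak_cvg x l ->
  exists2 M : R, 0 < M & forall n, `|x n| <= M.
Proof.
move=> xl; have [u|M M0 xM] := @pointwise_bounded_norm (range x).
  have /cvg_seq_bounded /bounded_inP[M _ xM] := cvgP _ (xl u).
  by exists M => _ [n _ <-]; exact: xM.
by exists M => // n; apply: xM; exists n.
Qed.

End Projection.

(** * Adjoint of a bounded operator and closed images *)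

Section Adjoint.
Context {R : realType} {H1 H2 : hilbertType R} {A : {linear H1 -> H2}}.
Hypothesis Abounded : bounded_fun_norm A.

Lemma bounded_linear_norm_le : exists2 K : R, 0 < K & forall x, `|A x| <= K * `|x|.
Proof.
have /bounded_funP/linear_boundedP/pinfty_ex_gt0[K K0 AK] := Abounded.
by exists K.
Qed.

(** Riesz representation of [x |-> <A x, y>] shows that the defining property of
[adjoint] is satisfiable, so that its default value is never taken. *)
Lemma adjointP x y : inner (A x) y = inner x (adjoint A y).
Proof.
have [K K0 AK] := bounded_linear_norm_le.
have [|||z zP] := @riesz _ _ (fun x => inner (A x) y) (K * (`|y| + 1)).
- by rewrite mulr_gt0// ltr_wpDl.
- by move=> a u v; rewrite linearP innerDl innerZl.
(* The constant is [|y| + 1] rather than [|y|] to be positive when [y = 0]. *)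
- move=> u; rewrite (le_trans (norm_inner_le _ _))//.
  rewrite mulrAC ler_pM// lerDl//.
by have /(_ x) := @xgetPex _ 0 [set z | forall x, inner (A x) y = inner x z]
  (ex_intro _ z zP).
Qed.

Lemma adjoint_linear : linear (adjoint A).
Proof.
move=> a u v; apply: inner_injr => x.
by rewrite -adjointP !innerDr !innerZr !adjointP.
Qed.

Lemma adjoint0 : adjoint A 0 = 0.
Proof. by apply: inner_injr => x; rewrite -adjointP !linear0r. Qed.

Lemma adjointZ a u : adjoint A (a *: u) = a *: adjoint A u.
Proof.
by apply: inner_injr => x; rewrite -adjointP !innerZr adjointP.
Qed.

Lemma weak_cvg_image (x : nat -> H1) (l : H1) :
  weak_cvg x l -> weak_cvg (A \o x) (A l).
Proof.
move=> xl y; rewrite adjointP.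
by under eq_fun do rewrite /= adjointP; exact: xl.
Qed.

Lemma range_linear_subspace : linear_subspace (range A).
Proof.
split; first by exists 0 => //; rewrite linear0.
by move=> a _ _ [u _ <-] [v _ <-]; exists (a *: u + v); rewrite ?linearP.
Qed.

(** Makes the factor in [landweber] invertible, so that the adjoint of the residual
of [T] can be recovered from the Landweber step. *)
Lemma opnorm_gt0 : (exists x, A x != 0) -> 0 < opnorm A.
Proof.
move=> [x Ax0]; have [M AM] := Abounded 1.
have x0 : `|x| != 0.
  by rewrite normr_eq0; apply: contra_neq Ax0 => ->; rewrite linear0.
apply: lt_le_trans (_ : `|A (`|x|^-1 *: x)| <= _).
  by rewrite linearZ/= normrZ mulr_gt0 ?normr_gt0 ?invr_neq0.
apply: ub_le_sup; first by exists M => _ [u u1 <-]; exact: AM.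
by exists (`|x|^-1 *: x) => //=; rewrite normrZ normfV normr_id mulVf.
Qed.

(** The vectors [y] of the image with [|A* y| <= 1] are pointwise bounded: as the
image is closed, [u] projects to some [A x], and
[<y, u> = <y, A x> = <A* y, x>] is at most [|x|].  Uniform boundedness and
scaling give the estimate. *)
Lemma closed_range_adjoint_lower_bound : closed (range A) ->
  exists2 K : R, 0 < K & forall y, range A y -> `|y| <= K * `|adjoint A y|.
Proof.
move=> Acl.
have [u|K K0 BK] := @pointwise_bounded_norm _ _
    [set y | range A y /\ `|adjoint A y| <= 1].
  have [p + up] := projection u range_linear_subspace.
  rewrite -(proj1 (closure_id _) Acl) => -[x _ xp].
  exists `|x| => y [Ay y1].
  have -> : inner y u = inner (adjoint A y) x.
    move: (up _ Ay); rewrite innerBl -xp (innerC u) adjointP (innerC x).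
    by move/eqP; rewrite subr_eq0 => /eqP.
  by rewrite (le_trans (norm_inner_le _ _))// ler_piMl.
exists K => // y Ay; have [ay0|ay0] := eqVneq (adjoint A y) 0.
  have [x _ xy] := Ay.
  have : `|y| ^+ 2 = 0 by rewrite -innerE -{1}xy adjointP ay0 linear0r.
  by move/eqP; rewrite sqrf_eq0 => /eqP ->; rewrite ay0 normr0 mulr0.
have n0 : 0 < `|adjoint A y| by rewrite normr_gt0.
have := BK (`|adjoint A y|^-1 *: y).
rewrite /= adjointZ normrZ normfV normr_id mulVf ?gt_eqF//.
rewrite normrZ normfV normr_id mulrC ler_pdivrMr//; apply; split=> //.
have [A0 Al] := range_linear_subspace.
by rewrite -[_ *: _]addr0; exact: Al.
Qed.

(** Let [p] be the projection of [x] onto the closure of [A* (im A)].  The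
difference [x - p] is orthogonal to [A* A (x - p)], so that [A p = A x].
Approximating [p] by [A* y] with [y] in the image gives
[|p|^2 ~ <p, A* y> = <A p, y> <= |A p| |y| <= K |A p| |A* y| ~ K |A p| |p|]. *)
Lemma closed_range_preimage_bound : closed (range A) ->
  exists2 K : R, 0 < K & forall x, exists2 w, A w = A x & `|w| <= K * `|A x|.
Proof.
move=> Acl; have [K K0 AK] := closed_range_adjoint_lower_bound Acl.
exists K => // x.
pose M := adjoint A @` range A.
have Msub : linear_subspace M.
  have [A0 Al] := range_linear_subspace; split.
    by exists 0 => //; exact: adjoint0.
  move=> a _ _ [u Au <-] [v Av <-]; exists (a *: u + v); first exact: Al.
  exact: adjoint_linear.
have [p pM px] := projection x Msub.
have Ap : A p = A x.
  apply/eqP; rewrite eq_sym -subr_eq0 -linearB -normr_eq0 -sqrf_eq0 -innerE.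
  by rewrite adjointP px//; exists (A (x - p)) => //; exists (x - p).
exists p => //; rewrite -Ap.
have [->|p0] := eqVneq p 0.
  by rewrite linear0 !normr0 mulr0.
rewrite -(@ler_pM2r _ `|p|) ?normr_gt0// -expr2.
(* The precision is chosen so that the error, at most
   [(|p| + K |A p|) |p - A* y|], is below [e]. *)
have N0 : 0 < `|p| + K * `|A p| by rewrite ltr_wpDr ?normr_gt0// mulr_ge0// ltW.
apply/ler_addgt0Pr => e e0.
have [_ [y Ay <-] py] := closure_approx pM (divr_gt0 e0 N0).
move: py; rewrite ltr_pdivlMr// => py.
have -> : `|p| ^+ 2 = inner p (p - adjoint A y) + inner (A p) y.
  by rewrite innerBr adjointP subrK innerE.
have h1 := inner_le_norm p (p - adjoint A y).
have h2 := inner_le_norm (A p) y.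
have h3 := ler_wpM2l (normr_ge0 (A p)) (AK y Ay).
have h4 : `|adjoint A y| <= `|p| + `|p - adjoint A y|.
  by rewrite -[X in `|X| <= _](subKr p) (le_trans (ler_normB _ _)).
have h5 := ler_wpM2l (mulr_ge0 (ltW K0) (normr_ge0 (A p))) h4.
lra.
Qed.

End Adjoint.

(** * Regularity of the Landweber operator *)

Section Landweber.
Context {R : realType} {H1 H2 : hilbertType R} {A : {linear H1 -> H2}}.
Context {T : H2 -> H2} {rho : R}.
Hypotheses (Abounded : bounded_fun_norm A) (Anonzero : exists x, A x != 0).
Hypotheses (rho_ge0 : 0 <= rho) (Tsqne : sqne rho T).

(** Expansion of [|(u - z) + (T u - u)|^2] in the inequality defining
quasi-nonexpansivity. *)
Lemma sqne_residual_le (u z : H2) : fixpts T z ->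
  `|T u - u| ^+ 2 <= 2 * inner (z - u) (T u - u).
Proof.
move=> /(Tsqne.2 u).
have -> : T u - z = (u - z) + (T u - u) by rewrite [RHS]addrC subrKA.
have -> : z - u = - (u - z) by rewrite opprB.
rewrite normDsq linearNl.
by have := mulr_ge0 rho_ge0 (sqr_ge0 `|T u - u|); lra.
Qed.

Lemma adjoint_residual x :
  adjoint A (T (A x) - A x) = opnorm A ^+ 2 *: (landweber A T x - x).
Proof.
rewrite /landweber [x + _]addrC addrK scalerA divff ?scale1r//.
by rewrite sqrf_eq0 gt_eqF// opnorm_gt0.
Qed.

(** Pass [A] to the other side of the inner product in [sqne_residual_le], where
[A* (T (A x) - A x)] is a multiple of the Landweber step, and apply
Cauchy-Schwarz. *)
Lemma landweber_residual_le (x z : H1) : fixpts T (A z) ->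
  `|T (A x) - A x| ^+ 2 <=
    2 * opnorm A ^+ 2 * (`|landweber A T x - x| * `|x - z|).
Proof.
move=> Tz; apply: le_trans (sqne_residual_le (A x) Tz) _.
rewrite -linearB adjointP// adjoint_residual innerZr mulrA ler_wpM2l//.
  by rewrite mulr_ge0// sqr_ge0.
by rewrite (le_trans (inner_le_norm _ _))// mulrC (distrC z).
Qed.

Hypothesis imA_FixT : range A `&` fixpts T !=set0.

(** If [x] is fixed by the Landweber operator, [landweber_residual_le] bounds the
residual of [T] at [A x] by zero, on choosing any fixed point of [T] in the
image. *)
Lemma fixpts_landweber : fixpts (landweber A T) = A @^-1` fixpts T.
Proof.
apply/seteqP; split=> x; rewrite /fixpts/= => fx; last first.
  by rewrite /landweber fx subrr adjoint0// scaler0 addr0.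
have [_ [[z _ <-] Tz]] := imA_FixT.
have := landweber_residual_le x Tz; rewrite fx subrr normr0 mul0r mulr0.
by rewrite exprn_even_le0//= normr_eq0 subr_eq0 => /eqP.
Qed.

Lemma fixpts_landweber_nonempty : fixpts (landweber A T) !=set0.
Proof.
by have [_ [[z _ <-] Tz]] := imA_FixT; exists z; rewrite fixpts_landweber.
Qed.

(** Infimum over [z] in [landweber_residual_le]; keeping the distance rather than
a bound on [|x - z|] is what the linear case needs. *)
Lemma landweber_residual_le_dist (x : H1) :
  `|T (A x) - A x| ^+ 2 <= 2 * opnorm A ^+ 2 *
    (`|landweber A T x - x| * dist x (fixpts (landweber A T))).
Proof.
have a0 : 0 < opnorm A ^+ 2 by rewrite exprn_gt0// opnorm_gt0.
have [L0|L0] := eqVneq `|landweber A T x - x| 0.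
  have [z] := fixpts_landweber_nonempty; rewrite fixpts_landweber => Tz.
  by have := landweber_residual_le x Tz; rewrite L0 !mul0r.
have L1 : 0 < `|landweber A T x - x| by rewrite lt_neqAle eq_sym L0 /=.
have m0 : 0 < 2 * opnorm A ^+ 2 * `|landweber A T x - x|.
  by apply: mulr_gt0 => //; apply: mulr_gt0.
rewrite mulrA -ler_pdivrMl//.
apply: le_dist fixpts_landweber_nonempty _ => z.
rewrite fixpts_landweber => Tz; rewrite ler_pdivrMl//.
by rewrite -[leRHS]mulrA; exact: landweber_residual_le.
Qed.

Lemma landweber_residual_cvg (x : nat -> H1) (M : R) :
  (forall k, `|x k| <= M) ->
  `|landweber A T (x k) - x k| @[k --> \oo] --> (0 : R) ->
  `|T (A (x k)) - A (x k)| @[k --> \oo] --> (0 : R).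
Proof.
move=> xM Lx; have [z] := fixpts_landweber_nonempty.
rewrite fixpts_landweber => Tz.
pose c := 2 * opnorm A ^+ 2 * (M + `|z|).
apply: (@squeeze_cvgr _ _ _ _ (cst 0)
  (fun k => Num.sqrt (c * `|landweber A T (x k) - x k|))).
- apply: nearW => k; rewrite normr_ge0/= -(ger0_norm (normr_ge0 _)) -sqrtr_sqr.
  rewrite ler_wsqrtr// (le_trans (landweber_residual_le (x k) Tz))//.
  rewrite /c -[leRHS]mulrA ler_wpM2l//; first by rewrite mulr_ge0 ?sqr_ge0.
  rewrite mulrC ler_wpM2r// (le_trans (ler_normB _ _))// lerD2r.
  exact: xM.
- exact: cvg_cst.
- rewrite -[X in _ --> X](@sqrtr0 R) -(mulr0 c).
  by apply: continuous_cvg; [exact: sqrt_continuous|exact: cvgMr].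
Qed.

(** For a fixed point [A z] of [T] in the image, let [w] be a short preimage of
[A x - A z]; then [x - w] is mapped to [A z], so it lies in the fixed point set,
at distance [|w|] from [x]. *)
Lemma dist_fixpts_landweber_le : closed (range A) ->
  exists2 K : R, 0 < K & forall x, dist x (fixpts (landweber A T)) <=
    K * dist (A x) (range A `&` fixpts T).
Proof.
move=> Acl; have [K K0 AK] := closed_range_preimage_bound Abounded Acl.
exists K => // x; rewrite -ler_pdivrMl//.
apply: le_dist imA_FixT _ => _ [[z _ <-] Tz]; rewrite ler_pdivrMl//.
have [w Aw wK] := AK (x - z).
rewrite -linearB; apply: le_trans wK.
have -> : w = x - (x - w) by rewrite subKr.
apply: dist_le; rewrite fixpts_landweber /= linearB Aw linearB.
by rewrite subKr.
Qed.

Lemma weakly_regular_landweber :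
  weakly_regular T -> weakly_regular (landweber A T).
Proof.
move=> [_ Treg]; split; first exact: fixpts_landweber_nonempty.
move=> x l n n_incr xl Lx; rewrite fixpts_landweber.
have [M _ xM] := weak_cvg_bounded xl.
apply: (Treg (A \o (x \o n)) (A l) id) => //; first exact: weak_cvg_image.
apply/norm_cvg0P; apply: (landweber_residual_cvg xM).
have /norm_cvg0P LX := Lx.
have n_oo : n k @[k --> \oo] --> \oo.
  move=> P [N _ NP]; exists N => // k Nk; apply: NP.
  have le_n j : (j <= n j)%N.
    elim: j => // j IHj; apply: leq_ltn_trans IHj _.
    by rewrite ltnNge; have := n_incr j.+1 j; rewrite leEnat ltnn => ->.
  exact: leq_trans Nk (le_n k).
exact: (cvg_comp n (fun k => `|landweber A T (x k) - x k|) n_oo LX).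
Qed.

Lemma boundedly_regular_landweber : closed (range A) ->
  boundedly_regular T ->
  boundedly_regular_family (tnth [tuple range A; fixpts T]) ->
  boundedly_regular (landweber A T).
Proof.
move=> Acl [Tfix Treg] [_ Creg]; split; first exact: fixpts_landweber_nonempty.
move=> x /bounded_inP[M M0 xM] Lx.
have Abnd : bounded_fun (A \o x).
  have [K K0 AK] := bounded_linear_norm_le Abounded.
  apply/bounded_inP; exists (K * M) => [|k _]; first exact: mulr_gt0.
  by rewrite (le_trans (AK _))// ler_pM2l// xM.
have Tx := landweber_residual_cvg (fun k => xM k I) Lx.
have := Creg _ Abnd; rewrite bigcap_pair.
have -> : (fun k => max_dist (tnth [tuple range A; fixpts T]) ((A \o x) k)) =
    (fun k => dist (A (x k)) (fixpts T)).
  by apply/funext => k; apply: max_dist_pair => //; exists (x k).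
move=> /(_ (Treg _ Abnd Tx)) ACx.
have [K K0 dK] := dist_fixpts_landweber_le Acl.
apply: (@squeeze_cvgr _ _ _ _ (cst 0)
  (fun k => K * dist (A (x k)) (range A `&` fixpts T))).
- apply: nearW => k; rewrite dK andbT.
  exact: dist_ge0 fixpts_landweber_nonempty.
- exact: cvg_cst.
- by rewrite -(mulr0 K); exact: cvgMr.
Qed.

(** Chaining the three linear estimates bounds [d = d(x, Fix L)] by a multiple
[q] of the residual of [T]; squaring and using [landweber_residual_le_dist]
gives [d^2 <= c |L x - x| d], where [d] can be cancelled. *)
Lemma boundedly_linearly_regular_landweber : closed (range A) ->
  boundedly_linearly_regular T ->
  boundedly_linearly_regular_family (tnth [tuple range A; fixpts T]) ->
  boundedly_linearly_regular (landweber A T).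
Proof.
move=> Acl [Tfix Treg] [_ Creg]; split; first exact: fixpts_landweber_nonempty.
move=> S /bounded_inP[M M0 SM].
have [KA KA0 AKA] := bounded_linear_norm_le Abounded.
have ASbnd : bounded_set (A @` S).
  apply/bounded_inP; exists (KA * M) => [|_ [x Sx <-]]; first exact: mulr_gt0.
  by rewrite (le_trans (AKA _))// ler_pM2l// SM.
have [delta delta0 dT] := Treg _ ASbnd.
have [kappa kappa0] := Creg _ ASbnd; rewrite bigcap_pair => kC.
have [K K0 dK] := dist_fixpts_landweber_le Acl.
have a0 : 0 < opnorm A ^+ 2 by rewrite exprn_gt0// opnorm_gt0.
pose q := K * kappa / delta.
pose c := q ^+ 2 * (2 * opnorm A ^+ 2).
have c0 : 0 < c.
  apply: mulr_gt0; last exact: mulr_gt0.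
  by rewrite exprn_gt0// divr_gt0// mulr_gt0.
exists c^-1 => [|x Sx]; first by rewrite invr_gt0.
rewrite ler_pdivrMl//.
set d := dist x _.
have d_res : d <= q * `|T (A x) - A x|.
  rewrite /q -!mulrA (le_trans (dK x))// ler_pM2l//.
  have ASx : (A @` S) (A x) by exists x.
  rewrite (le_trans (kC _ ASx))// max_dist_pair//.
  by rewrite ler_pM2l// ler_pdivlMl//; exact: dT.
have d0 : 0 <= d := dist_ge0 _ fixpts_landweber_nonempty.
have := d0; rewrite le_eqVlt => /predU1P[<-|dp].
  by rewrite mulr_ge0// ltW.
rewrite -(ler_pM2r dp) -expr2.
have : d ^+ 2 <= (q * `|T (A x) - A x|) ^+ 2.
  by rewrite lerXn2r// nnegrE// (le_trans d0).
move=> /le_trans; apply; rewrite exprMn /c.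
have := ler_wpM2l (sqr_ge0 q) (landweber_residual_le_dist x).
by rewrite -/d; lra.
Qed.

End Landweber.

Theorem corollary4p9 (R : realType) (H1 H2 : hilbertType R)
    (A : {linear H1 -> H2}) (T : H2 -> H2) (rho : R)
    (Abounded : bounded_fun_norm A)
    (Anonzero : exists x : H1, A x != 0)
    (rho_ge0 : 0 <= rho)
    (Tsqne : sqne rho T)
    (imA_FixT : range A `&` fixpts T !=set0) :
  [/\ weakly_regular T -> weakly_regular (landweber A T),
      closed (range A) ->
        boundedly_regular T ->
        boundedly_regular_family (tnth [tuple range A; fixpts T]) ->
        boundedly_regular (landweber A T)
    & closed (range A) ->
        boundedly_linearly_regular T ->
        boundedly_linearly_regular_family (tnth [tuple range A; fixpts T]) ->
        boundedly_linearly_regular (landweber A T) ].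
Proof.
split.
- exact: (weakly_regular_landweber Abounded Anonzero rho_ge0 Tsqne imA_FixT).
- exact: (boundedly_regular_landweber Abounded Anonzero rho_ge0 Tsqne imA_FixT).
- exact: (boundedly_linearly_regular_landweber
    Abounded Anonzero rho_ge0 Tsqne imA_FixT).
Qed.
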